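(* Let $A=\{a_0,\dots,a_k\}$ be a finite alphabet, let $W_0$ be a finite (possibly empty) word over $A$, and let $\boldsymbol\varepsilon=(\varepsilon_i)_{i\ge 0}$ be a periodic sequence with values in $A$, of period $n\ge 1$. Let $\mathbf u=\mathcal P(W_0,\boldsymbol\varepsilon)$. Then the continued fraction $\mathrm{CF}(\mathbf u)\in\mathbb F_2((A))$ is algebraic over $\mathbb F_2(A)$ of degree at most $2^n$.
   Context: The family $\mathcal P$: given a finite word $W_0$ over $A$ and a periodic sequence $\boldsymbol\varepsilon=(\varepsilon_i)_{i\ge0}$ in $A$ (period $n$ means $\varepsilon_{i+n}=\varepsilon_i$ for all $i\ge0$), define words by $W_{i+1}=W_i\,\varepsilon_i\,W_i$ (concatenation). Each $W_i$ is a prefix of $W_{i+1}$; $\mathcal P(W_0,\boldsymbol\varepsilon)$ denotes the infinite sequence $\lim_i W_i$. The letters $a_0,\dots,a_k$ of $A$ are treated as independent formal variables over the field $\mathbb F_2$. Put $\mathbb F_2[A]=\mathbb F_2[a_0,\dots,a_k]$, $\mathbb F_2(A)=\mathbb F_2(a_0,\dots,a_k)$, and let $\mathbb F_2((A))$ be the ring of power series of the form $\varphi=\sum_{n_0,\dots,n_k\ge N}c_{n_0,\dots,n_k}a_0^{-n_0}\cdots a_k^{-n_k}$ with $N\in\mathbb Z$ (depending on $\varphi$) and $c_{n_0,\dots,n_k}\in\mathbb F_2$. It contains $\mathbb F_2[A]$ and is an integral domain. The valuation is $\mathrm{val}(\varphi)=\min\{n_0+\cdots+n_k : c_{n_0,\dots,n_k}\ne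 0\}$ (with $\min\emptyset=\infty$), and the norm of $\varphi$ is $2^{-\mathrm{val}(\varphi)}$; convergence is with respect to this norm. For a sequence $\mathbf u=(u_i)_{i\ge0}$ in $A$, set $[u_0]=u_0$ and $[u_0,\dots,u_m]=u_0+1/[u_1,\dots,u_m]\in\mathbb F_2((A))$ for $m\ge1$; $\mathrm{CF}(\mathbf u)=[u_0,u_1,\dots]$ is the limit of $([u_0,\dots,u_m])_m$ in $\mathbb F_2((A))$ (this limit always exists). ''Algebraic over $\mathbb F_2(A)$ of degree at most $D$'' means being a root of a nonzero one-variable polynomial of degree at most $D$ with coefficients in $\mathbb F_2(A)$ (equivalently, after clearing denominators, in $\mathbb F_2[A]$). *)

(* Defs.v *)
From HB Require Import structures.
From mathcomp Require Import all_boot all_order all_algebra.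
From mathcomp Require Import boolp classical_sets functions cardinality fsbigop.
From mathcomp Require Import mpoly zify.

Set Implicit Arguments.
Unset Strict Implicit.
Unset Printing Implicit Defensive.

Import Order.TTheory GRing.Theory Num.Theory.
Local Open Scope ring_scope.

(* The alphabet {a_0, ..., a_k} is 'I_k.+1.  An exponent n : expo k stands for
   the monomial a_0^(- n 0) ... a_k^(- n k), with the sign convention of
   power series in the inverses of the letters. *)
Notation expo k := {ffun 'I_k.+1 -> int}.

(* f n is the coefficient of the monomial with exponent n; laurent k is the
   ring F_2((A)). *)
Definition bounded_by (k : nat) (f : expo k -> 'F_2) (N : int) : Prop :=
  forall n, f n != 0 -> forall i, N <= n i.

Record laurent (k : nat) := Laurent {
  coef :> expo k -> 'F_2;
  coef_bounded : exists N, bounded_by coef N }.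

HB.instance Definition _ k := gen_eqMixin (laurent k).
HB.instance Definition _ k := gen_choiceMixin (laurent k).

Section Ring.
Variable k : nat.
Implicit Types (f g h : expo k -> 'F_2) (x y z : laurent k) (n p q : expo k).

Lemma laurentP x y : (forall n, x n = y n) -> x = y.
Proof.
case: x y => [f Hf] [g Hg] /= fg.
have E : f = g by apply/funext.
by rewrite E in Hf *; rewrite (Prop_irrelevance Hf Hg).
Qed.

Lemma bounded_le f N M : M <= N -> bounded_by f N -> bounded_by f M.
Proof. by move=> MN fN n fn i; apply: (le_trans MN); exact: fN. Qed.

Lemma bounded2 x y : exists N, bounded_by x N /\ bounded_by y N.
Proof.
have [[a xa] [b yb]] := (coef_bounded x, coef_bounded y).
exists (Order.min a b); split.
  by apply: bounded_le xa; rewrite ge_min lexx.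
by apply: bounded_le yb; rewrite ge_min lexx orbT.
Qed.

Definition lzero : laurent k.
Proof. by exists (fun=> 0); exists 0 => n; rewrite eqxx. Defined.

Definition lopp x : laurent k.
Proof.
exists (fun n => - x n); have [N xN] := coef_bounded x.
by exists N => n; rewrite oppr_eq0; exact: xN.
Defined.

Definition ladd x y : laurent k.
Proof.
exists (fun n => x n + y n); have [N [xN yN]] := bounded2 x y.
exists N => n; have [->|/xN //] := eqVneq (x n) 0.
by rewrite add0r => /yN.
Defined.

Lemma laddA : associative ladd.
Proof. by move=> x y z; apply: laurentP => n /=; rewrite addrA. Qed.
Lemma laddC : commutative ladd.
Proof. by move=> x y; apply: laurentP => n /=; rewrite addrC. Qed.
Lemma ladd0 : left_id lzero ladd.
Proof. by move=> x; apply: laurentP => n /=; rewrite add0r. Qed.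
Lemma laddN : left_inverse lzero lopp ladd.
Proof. by move=> x; apply: laurentP => n /=; rewrite addNr. Qed.

HB.instance Definition _ := GRing.isZmodule.Build (laurent k) laddA laddC ladd0 laddN.

Lemma coef0 n : (0 : laurent k) n = 0. Proof. by []. Qed.
Lemma coefD x y n : (x + y) n = x n + y n. Proof. by []. Qed.
Lemma coefN x n : (- x) n = - x n. Proof. by []. Qed.
Lemma coefB x y n : (x - y) n = x n - y n. Proof. by []. Qed.
Lemma coef_sum I (r : seq I) (P : pred I) (F : I -> laurent k) n :
  (\sum_(i <- r | P i) F i) n = \sum_(i <- r | P i) F i n.
Proof. by elim/big_rec2: _ => // i u v _ <-; rewrite coefD. Qed.

(* A finitely supported sum: all but finitely many terms vanish as soon as f
   and g have bounded support. *)
Definition conv f g : expo k -> 'F_2 :=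
  fun n => \sum_(p \in [set: expo k]) f p * g (n - p).

Definition box (a : int) n (c : int) : set (expo k) :=
  [set p | forall i, a <= p i /\ p i <= n i - c].

Lemma finite_box a n c : finite_set (box a n c).
Proof.
pose M := (\max_(i : 'I_k.+1) absz (n i - c - a)%R).+1.
pose F (t : {ffun 'I_k.+1 -> 'I_M}) : expo k := [ffun i => a + (t i : nat)%:Z].
apply: (@sub_finite_set _ _ (F @` setT)); last exact/finite_image/finite_finset.
move=> p Hp.
have Hi i : (absz (p i - a)%R < M)%N.
  rewrite ltnS; apply: leq_trans (leq_bigmax i).
  have [Ha Hc] := Hp i.
  by rewrite -lez_nat !gez0_abs ?subr_ge0 ?(le_trans Ha Hc) // lerB.
exists [ffun i => Ordinal (Hi i)] => //; apply/ffunP => i.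
have [Ha _] := Hp i.
by rewrite !ffunE /= gez0_abs ?subr_ge0 // addrC subrK.
Qed.

Lemma convE (D : set (expo k)) f g n :
  (forall p, f p != 0 -> g (n - p) != 0 -> D p) ->
  conv f g n = \sum_(p \in D) f p * g (n - p).
Proof.
move=> DP; symmetry; apply: fsbig_widen => // p [_ NDp] /=.
have [->|fp] := eqVneq (f p) 0; first by rewrite mul0r.
have [->|gp] := eqVneq (g (n - p)) 0; first by rewrite mulr0.
by case: NDp; exact: DP.
Qed.

Lemma conv_boxE f g a b n : bounded_by f a -> bounded_by g b ->
  conv f g n = \sum_(p \in box a n b) f p * g (n - p).
Proof.
move=> fa gb; apply: convE => p fp gp i; split; first exact: fa.
by have := gb _ gp i; rewrite !ffunE lerBrDr addrC -lerBrDr.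
Qed.

Lemma conv_supp f g n : conv f g n != 0 -> exists2 p, f p != 0 & g (n - p) != 0.
Proof.
move=> C; apply: contrapT => H; move/eqP: C; apply; apply: fsbig1 => p _.
have [->|fp] := eqVneq (f p) 0; first by rewrite mul0r.
have [->|gp] := eqVneq (g (n - p)) 0; first by rewrite mulr0.
by case: H; exists p.
Qed.

Lemma conv_bounded f g a b : bounded_by f a -> bounded_by g b ->
  bounded_by (conv f g) (a + b).
Proof.
move=> fa gb n /conv_supp[p /fa fp /gb gp] i.
have := lerD (fp i) (gp i); rewrite !ffunE.
by rewrite addrC [X in _ <= X]addrC subrK addrC.
Qed.

Definition lmul x y : laurent k.
Proof.
exists (conv x y); have [[a xa] [b yb]] := (coef_bounded x, coef_bounded y).
by exists (a + b); exact: conv_bounded.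
Defined.

Lemma lmulC : commutative lmul.
Proof.
move=> x y; apply: laurentP => n /=; rewrite /conv.
rewrite (@reindex_fsbigT _ _ _ _ _ (fun p : expo k => n - p)); last first.
  by exists (fun p => n - p) => p; rewrite opprB addrC subrK.
by apply: eq_fsbigr => p _; rewrite opprB [n + (p - n)]addrC subrK mulrC.
Qed.

Lemma int_shift (u p q m : int) : u <= (p - q) + (m - p) -> q <= m - u.
Proof. lia. Qed.
Lemma int_shift2 (u p q m : int) : u <= p + (m - q - p) -> q <= m - u.
Proof. lia. Qed.
Lemma int_shift3 (u p q m : int) : u <= m - q - (p - q) -> p <= m - u.
Proof. lia. Qed.

Lemma lmulA : associative lmul.
Proof.
move=> x y z; apply: laurentP => n /=.
have [a xa] := coef_bounded x; have [b yb] := coef_bounded y.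
have [c zc] := coef_bounded z.
pose B := box a n (b + c); pose P := box (a + b) n c.
have fB : finite_set B by exact: finite_box.
have fP : finite_set P by exact: finite_box.
have -> : conv (conv x y) z n =
    \sum_(p \in P) \sum_(q \in B) x q * y (p - q) * z (n - p).
  rewrite (conv_boxE _ (conv_bounded xa yb) zc); apply: eq_fsbigr => p _.
  have [z0|zp] := eqVneq (z (n - p)) 0.
    by rewrite z0 mulr0 fsbig1 // => q _; rewrite mulr0.
  rewrite (@convE B) ?mulr_fsuml // => q xq yq i; split; first exact: xa.
  have := lerD (yb _ yq i) (zc _ zp i); rewrite !ffunE => H.
  exact: int_shift H.
rewrite exchange_fsbig //.
rewrite (@convE B); last first.
  move=> q xq /conv_supp[p yp zp] i; split; first exact: xa.
  have := lerD (yb _ yp i) (zc _ zp i); rewrite !ffunE => H.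
  exact: int_shift2 H.
apply: eq_fsbigr => q _.
have [x0|xq] := eqVneq (x q) 0.
  by rewrite x0 mul0r fsbig1 // => p _; rewrite !mul0r.
under [RHS]eq_fsbigr => p _ do rewrite -mulrA.
rewrite -mulr_fsumr; congr (_ * _); rewrite /conv.
rewrite (@reindex_fsbigT _ _ _ _ _ (fun p : expo k => p - q)); last first.
  by exists (fun p => p + q) => p; rewrite ?addrK ?subrK.
transitivity (\sum_(p \in P) y (p - q) * z (n - q - (p - q))).
  symmetry; apply: fsbig_widen => // p [_ NP] /=.
  have [->|yp] := eqVneq (y (p - q)) 0; first by rewrite mul0r.
  have [->|zp] := eqVneq (z (n - q - (p - q))) 0; first by rewrite mulr0.
  case: NP => i; split.
    have := lerD (xa _ xq i) (yb _ yp i); rewrite !ffunE.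
    by rewrite [q i + _]addrC subrK.
  have := zc _ zp i; rewrite !ffunE => H.
  exact: int_shift3 H.
apply: eq_fsbigr => p _; congr (_ * z _).
by rewrite opprB addrA subrK.
Qed.

(* The monomial a_0^(- n 0) ... a_k^(- n k). *)
Definition lmono n : laurent k.
Proof.
exists (fun m => (m == n)%:R).
exists (\big[Order.min/0]_i n i) => m Hm; have -> : m = n by apply: contra_neq_eq Hm => /negPf->.
by move=> i; exact: bigmin_le_cond.
Defined.

Lemma conv_monoE x n m : conv (lmono n) x m = x (m - n).
Proof.
rewrite (@convE [set n]) => [|p /=]; last first.
  by case: (p =P n) => // _; rewrite eqxx.
by rewrite fsbig_set1 /= eqxx mul1r.
Qed.

Definition lone := lmono 0.

Lemma lmul1 : left_id lone lmul.
Proof. by move=> x; apply: laurentP => n /=; rewrite conv_monoE subr0. Qed.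

Lemma lmulDl : left_distributive lmul ladd.
Proof.
move=> x y z; apply: laurentP => n /=.
have [a [xa ya]] := bounded2 x y; have [b zb] := coef_bounded z.
rewrite (conv_boxE _ xa zb) (conv_boxE _ ya zb) -fsbig_split; last exact: finite_box.
rewrite (@convE (box a n b)).
  by apply: eq_fsbigr => p _ /=; rewrite mulrDl.
move=> p xyp zp i; split; last first.
  by have := zb _ zp i; rewrite !ffunE lerBrDr addrC -lerBrDr.
have [x0|/xa//] := eqVneq (x p) 0.
by move: xyp; rewrite /= x0 add0r => /ya.
Qed.

Lemma lone_neq0 : lone != 0.
Proof.
apply/eqP => /(congr1 (fun x : laurent k => x 0)) /=.
by rewrite eqxx.
Qed.

HB.instance Definition _ := GRing.Zmodule_isComNzRing.Build (laurent k)
  lmulA lmulC lmul1 lmulDl lone_neq0.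

Lemma coefM x y n : (x * y) n = \sum_(p \in [set: expo k]) x p * y (n - p).
Proof. by []. Qed.

(* F_2((A)) is not a field when k > 0. *)
Definition lunit : pred (laurent k) := fun x => `[< exists y, y * x = 1 >].
(* Outside the units the inverse is the identity, as for all unitRingType's. *)
Definition linv x : laurent k :=
  if pselect (exists y, y * x = 1) is left H then projT1 (cid H) else x.

Lemma lmulVx : {in lunit, left_inverse 1 linv *%R}.
Proof.
move=> x /asboolP Hx; rewrite /linv; case: pselect => // H.
by case: cid.
Qed.
Lemma lunitP x y : y * x = 1 -> lunit x.
Proof. by move=> yx; apply/asboolP; exists y. Qed.
Lemma linv_out : {in [predC lunit], linv =1 id}.
Proof.
move=> x; rewrite inE /= => /asboolP Hx; rewrite /linv; case: pselect => //.
Qed.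

HB.instance Definition _ := GRing.ComNzRing_hasMulInverse.Build (laurent k)
  lmulVx lunitP linv_out.

Lemma int_min (Q : int -> Prop) N : (forall v, Q v -> N <= v) ->
  (exists v, Q v) -> exists v, Q v /\ forall w, Q w -> v <= w.
Proof.
move=> QN [v Qv].
have E w : Q w -> w = N + `|w - N|%N%:Z.
  by move=> /QN Nw; lia.
have ex : exists m, (fun m : nat => `[< Q (N + m%:Z) >]) m.
  by exists `|v - N|%N; apply/asboolP; rewrite -E.
case: (ex_minnP ex) => m /asboolP Qm mmin.
exists (N + m%:Z); split => // w Qw; rewrite (E w Qw) lerD2l lez_nat mmin //.
by apply/asboolP; rewrite -E.
Qed.

Definition lexlt n p : Prop :=
  exists i : 'I_k.+1, (forall j : 'I_k.+1, (j < i)%N -> n j = p j) /\ n i < p i.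

Lemma lex_min x : x != 0 -> exists n, x n != 0 /\
  forall p, x p != 0 -> p <> n -> lexlt n p.
Proof.
move=> x0; have [N xN] := coef_bounded x.
have [n0 xn0] : exists n, x n != 0.
  apply: contrapT => H; move/eqP: x0; apply; apply: laurentP => n.
  by apply/eqP/negPn/negP => xn; apply: H; exists n.
suff H t : exists n, x n != 0 /\ forall p, x p != 0 ->
    (forall j : 'I_k.+1, (j < t)%N -> n j = p j) \/ lexlt n p.
  have [n [xn nmin]] := H k.+1; exists n; split => // p /nmin[E|//] [].
  by apply/ffunP => i; rewrite E.
elim: t => [|t [n [xn nmin]]]; first by exists n0; split=> // p _; left.
have [tk|kt] := ltnP t k.+1; last first.
  exists n; split=> // p /nmin[E|]; [left => j _|by right].
  by apply: E; apply: leq_trans kt.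
pose T := Ordinal tk.
pose Q v := exists p, [/\ x p != 0, forall j : 'I_k.+1, (j < t)%N -> n j = p j & p T = v].
have [v [[p [xp np pv]] vmin]] : exists v, Q v /\ forall w, Q w -> v <= w.
  apply: (@int_min _ N); last by exists (n T); exists n.
  by move=> v [p [/xN/(_ T) Np _ <-]].
exists p; split => // r xr.
case: (nmin r xr) => [nr|[i [nri ni]]].
  have := vmin (r T) (ex_intro _ r (And3 xr nr erefl)).
  rewrite le_eqVlt => /orP[/eqP vr|vr].
    left => j; rewrite ltnS leq_eqVlt => /orP[/eqP jt|jt]; last by rewrite -np // nr.
    by rewrite (_ : j = T) ?pv //; apply: val_inj.
  right; exists T; split => [j jt|]; last by rewrite pv.
  by rewrite -np // nr.
have [it|ti] := ltnP i t.
  right; exists i; split => [j ji|]; last by rewrite -np.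
  by rewrite -np ?(ltn_trans ji) // nri.
have nr (j : 'I_k.+1) : (j < t)%N -> n j = r j by move=> jt; rewrite nri // (leq_trans jt).
have := vmin (r T) (ex_intro _ r (And3 xr nr erefl)).
rewrite le_eqVlt => /orP[/eqP vr|vr].
  left => j; rewrite ltnS leq_eqVlt => /orP[/eqP jt|jt]; last by rewrite -np // nr.
  by rewrite (_ : j = T) ?pv //; apply: val_inj.
right; exists T; split => [j jt|]; last by rewrite pv.
by rewrite -np // nr.
Qed.

Lemma lmulf_eq0 x y : x * y = 0 -> (x == 0) || (y == 0).
Proof.
move=> xy; apply/negPn/negP; rewrite negb_or => /andP[/lex_min[n [xn nm]] /lex_min[m [ym mm]]].
have := congr1 (fun z : laurent k => z (n + m)) xy.
rewrite coefM -/(conv x y (n + m)) (@convE [set n]) => [|p xp yp /=].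
  rewrite fsbig_set1 [n + m]addrC addrK => /eqP.
  by rewrite coef0 mulf_eq0 (negPf xn) (negPf ym).
apply: contrapT => pn; have [i [ni iI]] := nm _ xp pn.
have [|j [mj jI]] := mm _ yp.
  move=> E; apply: pn; have : n + m - p = m by [].
  by move/(canRL (subrK _)); rewrite addrC => /addrI.
have E l : p l + (n + m - p) l = n l + m l.
  by rewrite !ffunE [p l + _]addrC subrK.
have [ij|ji] := leqP i j.
  have := E i; apply/eqP; rewrite gt_eqF // ltr_leD //.
  move: ij; rewrite leq_eqVlt => /orP[/eqP/val_inj ->|ij]; first exact: ltW.
  by rewrite mj.
by have := E j; apply/eqP; rewrite gt_eqF // -ni // ltrD2l.
Qed.

HB.instance Definition _ := GRing.ComUnitRing_isIntegral.Build (laurent k) lmulf_eq0.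

End Ring.

Section RationalFunctions.
Variable k : nat.
Implicit Types (x y : laurent k) (n m : expo k).

(* The letter a_i, i.e. the monomial with exponent -1 at i. *)
Definition letter (i : 'I_k.+1) : laurent k :=
  lmono [ffun j => - (i == j)%:R].

Definition lconst (c : 'F_2) : laurent k.
Proof.
exists (fun n => c *+ (n == 0)); exists 0 => n.
by have [->|] := eqVneq n 0; rewrite ?eqxx // => _ i; rewrite ffunE.
Defined.

Lemma lconst_is_zmod_morphism : zmod_morphism lconst.
Proof. by move=> c d; apply: laurentP => n; rewrite coefB /= mulrnBl. Qed.

HB.instance Definition _ :=
  GRing.isZmodMorphism.Build _ _ lconst lconst_is_zmod_morphism.

Lemma coef_lconstM c x n : (lconst c * x) n = c * x n.
Proof.
rewrite coefM -/(conv _ _ n) (@convE _ [set 0]) => [|p /=]; last first.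
  by case: (p =P 0).
by rewrite fsbig_set1 /= eqxx mulr1n subr0.
Qed.

Lemma lconst_is_monoid_morphism : monoid_morphism lconst.
Proof.
split=> [|c d]; apply: laurentP => n //.
by rewrite coef_lconstM /= mulrnAr.
Qed.

HB.instance Definition _ :=
  GRing.isMonoidMorphism.Build _ _ lconst lconst_is_monoid_morphism.

Definition poly_embed : {mpoly 'F_2[k.+1]} -> laurent k := mmap lconst letter.

HB.instance Definition _ := GRing.RMorphism.on poly_embed.

Lemma lmonoD n m : lmono n * lmono m = lmono (n + m).
Proof.
apply: laurentP => p; rewrite coefM -/(conv _ _ p) conv_monoE /=.
by rewrite subr_eq addrC.
Qed.

Lemma mmap1_letter (m : 'X_{1..k.+1}) :
  mmap1 letter m = lmono [ffun i => - (m i)%:Z].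
Proof.
have pow i e : letter i ^+ e = lmono [ffun j => - ((i == j) * e)%:Z].
  elim: e => [|e IH].
    by rewrite expr0; congr lmono; apply/ffunP => j; rewrite !ffunE muln0.
  rewrite exprS IH lmonoD; congr lmono; apply/ffunP => j; rewrite !ffunE.
  by case: (i == j) => /=; lia.
have prod (r : seq 'I_k.+1) :
  \prod_(i <- r) letter i ^+ m i = lmono (\sum_(i <- r) [ffun j => - ((i == j) * m i)%:Z]).
  elim: r => [|i r IH]; first by rewrite !big_nil.
  by rewrite !big_cons IH pow lmonoD.
rewrite /mmap1 prod; congr lmono; apply/ffunP => j.
rewrite sum_ffunE ffunE (bigD1 j) //= big1 => [|i ij]; rewrite ffunE.
  by rewrite eqxx mul1n addr0.
by rewrite (negPf ij) mul0n.
Qed.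

Lemma coef_poly_embed (p : {mpoly 'F_2[k.+1]}) (m : 'X_{1..k.+1}) :
  poly_embed p [ffun i => - (m i)%:Z] = p@_m.
Proof.
rewrite /poly_embed /mmap coef_sum.
transitivity (\sum_(m' <- msupp p) p@_m' *+ (m == m')).
  apply: eq_bigr => m' _; rewrite coef_lconstM mmap1_letter /= mulr_natr.
  congr (_ *+ nat_of_bool _); apply/eqP/eqP => [|-> //].
  by move/ffunP => E; apply/mnmP => i; have := E i; rewrite !ffunE => /oppr_inj[].
rewrite [in RHS](mpolyE p) raddf_sum /=; apply: eq_bigr => m' _.
by rewrite mcoeffZ mcoeffX eq_sym mulr_natr.
Qed.

Lemma poly_embed_inj : injective poly_embed.
Proof.
move=> p q pq; apply/mpolyP => m.
by rewrite -!coef_poly_embed pq.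
Qed.

(* The induced embedding of F_2(A) into the fraction field of the integral
   domain F_2((A)).  (F_2(A) is not a subring of F_2((A)) itself when k > 0:
   for instance a_0 + a_1 is not invertible there.) *)
Definition rat_embed (r : {fraction {mpoly 'F_2[k.+1]}}) : {fraction laurent k} :=
  FracField.tofrac (poly_embed \n_(repr r)) /
  FracField.tofrac (poly_embed \d_(repr r)).

Local Notation "x %:F" := (FracField.tofrac x).

Lemma frac_numden (T : idomainType) (r : {fraction T}) :
  r = (\n_(repr r))%:F / (\d_(repr r))%:F.
Proof.
have dn0 : (\d_(repr r))%:F != 0 by rewrite tofrac_eq0 denom_ratioP.
apply: (mulIf dn0); rewrite mulfVK //.
rewrite -[X in X * _]reprK; move: (repr r) => x.
unlock FracField.tofrac; rewrite -[LHS]FracField.pi_mul; apply/eqmodP => /=.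
rewrite FracField.equivfE /FracField.mulf !numden_Ratio ?oner_eq0 ?mulf_neq0 ?oner_eq0 ?denom_ratioP //.
by rewrite mulr1 mulr1 mulrC.
Qed.

Lemma poly_embed_eq0 (p : {mpoly 'F_2[k.+1]}) : (poly_embed p == 0) = (p == 0).
Proof. by rewrite -(inj_eq poly_embed_inj) rmorph0. Qed.

Lemma rat_embedE (p q : {mpoly 'F_2[k.+1]}) : q != 0 ->
  rat_embed (p%:F / q%:F) = (poly_embed p)%:F / (poly_embed q)%:F.
Proof.
move=> q0; rewrite /rat_embed; set r := p%:F / q%:F.
have d0 : \d_(repr r) != 0 by rewrite denom_ratioP.
have /eqP : p%:F / q%:F = (\n_(repr r))%:F / (\d_(repr r))%:F := frac_numden r.
rewrite eqr_div ?tofrac_eq0 // -!tofracM tofrac_eq => /eqP E.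
apply/eqP; rewrite eqr_div ?tofrac_eq0 ?poly_embed_eq0 // -!tofracM tofrac_eq.
by rewrite -!rmorphM -E mulrC.
Qed.

Lemma frac_ind (T : idomainType) (P : {fraction T} -> Prop) :
  (forall p q, q != 0 -> P (p%:F / q%:F)) -> forall r, P r.
Proof. by move=> H r; rewrite (frac_numden r); apply: H; rewrite denom_ratioP. Qed.

Lemma rat_embed_poly (p : {mpoly 'F_2[k.+1]}) : rat_embed p%:F = (poly_embed p)%:F.
Proof.
by rewrite -[p%:F]divr1 -[1]tofrac1 rat_embedE ?oner_eq0 // rmorph1 tofrac1 divr1.
Qed.

Lemma rat_embed_is_zmod_morphism : zmod_morphism rat_embed.
Proof.
elim/frac_ind => p q q0; elim/frac_ind => p' q' q'0.
rewrite -mulNr addf_div ?tofrac_eq0 // -tofracN -!tofracM -tofracD.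
rewrite !rat_embedE ?mulf_neq0 // -mulNr addf_div ?tofrac_eq0 ?poly_embed_eq0 //.
by rewrite -tofracN -!tofracM -tofracD rmorphD !rmorphM rmorphN.
Qed.

HB.instance Definition _ :=
  GRing.isZmodMorphism.Build _ _ rat_embed rat_embed_is_zmod_morphism.

Lemma rat_embed_is_monoid_morphism : monoid_morphism rat_embed.
Proof.
split; first by rewrite -tofrac1 rat_embed_poly rmorph1 tofrac1.
elim/frac_ind => p q q0; elim/frac_ind => p' q' q'0.
by rewrite mulf_div -!tofracM !rat_embedE ?mulf_neq0 // mulf_div -!tofracM !rmorphM.
Qed.

HB.instance Definition _ :=
  GRing.isMonoidMorphism.Build _ _ rat_embed rat_embed_is_monoid_morphism.

Definition algebraic_of_degree_le (D : nat) (x : laurent k) : Prop :=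
  exists P : {poly {fraction {mpoly 'F_2[k.+1]}}},
    [/\ P != 0, (size P <= D.+1)%N & root (map_poly rat_embed P) x%:F].

End RationalFunctions.

Section ValuationAndNorm.
Variable k : nat.
Implicit Types (x y : laurent k) (n : expo k).

Definition is_val x (v : int) : Prop :=
  (exists n, x n != 0 /\ \sum_i n i = v) /\
  (forall n, x n != 0 -> v <= \sum_i n i).

Lemma val_exists x : x != 0 -> exists v, is_val x v.
Proof.
move=> x0; have [N xN] := coef_bounded x.
have [||v [[n [xn nv]] vmin]] :=
  @int_min (fun v => exists n, x n != 0 /\ \sum_i n i = v) (\sum_(i < k.+1) N).
- by move=> _ [n [xn <-]]; apply: ler_sum => i _; exact: xN.
- apply: contrapT => H; move/eqP: x0; apply; apply: laurentP => n.
  by apply/eqP/negPn/negP => xn; apply: H; exists (\sum_i n i), n.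
exists v; split; first by exists n.
by move=> m xm; apply: vmin; exists m.
Qed.

(* None stands for the infinite valuation of 0. *)
Definition val x : option int :=
  if pselect (x != 0) is left x0 then Some (projT1 (cid (val_exists x0))) else None.

Lemma valP x v : val x = Some v <-> is_val x v.
Proof.
rewrite /val; case: pselect => [x0|/negP/negPn/eqP ->]; last first.
  by split=> // -[[n []]]; rewrite coef0 eqxx.
case: cid => w Hw /=; split => [[<-] //|Hv]; congr Some.
have [[n [xn <-]] wm] := Hw; have [[m [xm <-]] vm] := Hv.
by apply: le_anti; apply/andP; split; [exact: (wm m)|exact: (vm n)].
Qed.

Lemma val_None x : val x = None <-> x = 0.
Proof.
rewrite /val; case: pselect => [x0|/negP/negPn/eqP ->] //.
by split=> // x00; have := x0; rewrite {1}x00 eqxx.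
Qed.

Definition norm x : rat := if val x is Some v then 2%:R ^ (- v) else 0.

Definition converges (s : nat -> laurent k) (l : laurent k) : Prop :=
  forall e : rat, 0 < e -> exists M, forall m, (M <= m)%N -> norm (s m - l) < e.

Lemma norm_ltP x (d : nat) :
  norm x < 2%:R ^ (- d%:Z) <-> (forall n, x n != 0 -> d%:Z < \sum_i n i).
Proof.
rewrite /norm; case E: (val x) => [v|].
  have /valP[[n [xn nv]] vm] := E.
  rewrite ltr_eXz2l //; split => [vd m xm|H]; last by have := H n xn; rewrite nv; lia.
  by apply: lt_le_trans (vm m xm); lia.
have /val_None -> := E; split=> [_ n|_]; first by rewrite coef0 eqxx.
by rewrite exprz_gt0.
Qed.

Lemma converges_unique s l l' : converges s l -> converges s l' -> l = l'.
Proof.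
move=> sl sl'; apply: laurentP => n.
have e0 : 0 < (2%:R : rat) ^ (- (absz (\sum_i n i))%:Z) by rewrite exprz_gt0.
have [M HM] := sl _ e0; have [M' HM'] := sl' _ e0.
pose m := maxn M M'.
have /norm_ltP/(_ n) H := HM m (leq_maxl _ _).
have /norm_ltP/(_ n) H' := HM' m (leq_maxr _ _).
have [/eqP|/H] := eqVneq ((s m - l) n) 0; last by lia.
have [/eqP|/H'] := eqVneq ((s m - l') n) 0; last by lia.
by rewrite !coefB !subr_eq0 => /eqP <- /eqP <-.
Qed.

End ValuationAndNorm.

Section ContinuedFractions.
Variable k : nat.
Implicit Types (x y : laurent k) (n : expo k) (u : nat -> 'I_k.+1).

(* cfrac [:: u_0; ...; u_m] is [u_0, ..., u_m]; the denominators that occur are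
   units of F_2((A)) by cfrac_unit, and the value at [::] is a dummy. *)
Fixpoint cfrac (s : seq 'I_k.+1) : laurent k :=
  match s with
  | [::] => 0
  | [:: a] => letter a
  | a :: s' => letter a + 1 / cfrac s'
  end.

Definition convergent u (m : nat) : laurent k := cfrac (mkseq u m.+1).

(* The limit of the convergents; see CF_cvg and converges_unique for existence
   and uniqueness. *)
Definition CF u : laurent k := xget 0 [set l | converges (convergent u) l].

(* x is a power series in the inverses of the letters, of valuation >= d. *)
Definition vge (d : nat) x :=
  forall n, x n != 0 -> (forall i, 0 <= n i) /\ d%:Z <= \sum_i n i.

Lemma vge_le d e x : (d <= e)%N -> vge e x -> vge d x.
Proof. by move=> de xe n /xe[n0 en]; split=> //; lia. Qed.

Lemma vge0 d : vge d 0. Proof. by move=> n; rewrite coef0 eqxx. Qed.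

Lemma vgeN d x : vge d x -> vge d (- x).
Proof. by move=> xd n; rewrite coefN oppr_eq0; exact: xd. Qed.

Lemma vgeD d x y : vge d x -> vge d y -> vge d (x + y).
Proof.
move=> xd yd n; rewrite coefD; have [->|/xd //] := eqVneq (x n) 0.
by rewrite add0r => /yd.
Qed.

Lemma vgeB d x y : vge d x -> vge d y -> vge d (x - y).
Proof. by move=> xd yd; apply: vgeD => //; exact: vgeN. Qed.

Lemma vgeM d e x y : vge d x -> vge e y -> vge (d + e) (x * y).
Proof.
move=> xd ye n; rewrite coefM => /conv_supp[p /xd[p0 dp] /ye[q0 eq]].
set q := n - p in q0 eq; have -> : n = p + q by rewrite addrC subrK.
split=> [i|]; first by rewrite ffunE addr_ge0.
have -> : \sum_i (p + q) i = \sum_i p i + \sum_i q i.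
  by rewrite -big_split; apply: eq_bigr => i _; rewrite ffunE.
by rewrite PoszD lerD.
Qed.

Lemma vge_mono n : (forall i, 0 <= n i) -> vge (absz (\sum_i n i)) (lmono n).
Proof.
move=> n0 m /= mn; have -> : m = n by apply: contra_neq_eq mn => /negPf->.
by split=> //; rewrite gez0_abs // sumr_ge0.
Qed.

Lemma vge1 : vge 0 1.
Proof. by apply: vge_le (vge_mono _) => // i; rewrite ffunE. Qed.

Lemma vge_all x : (forall d, vge d x) -> x = 0.
Proof.
move=> H; apply: laurentP => n; apply/eqP/negPn/negP => xn.
by have [_] := H (absz (\sum_i n i)).+1 n xn; lia.
Qed.

Lemma laurent_complete (s : nat -> laurent k) : (forall m, vge m (s m.+1 - s m)) ->
  exists l, forall m, vge m (l - s m).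
Proof.
move=> Hs.
have Hd m j : vge m (s (m + j)%N - s m).
  elim: j => [|j IH]; first by rewrite addn0 subrr; exact: vge0.
  rewrite addnS -(subrK (s (m + j)%N) (s _)) -addrA; apply: vgeD IH.
  by apply: vge_le (Hs _); exact: leq_addr.
pose f n := s (absz (\sum_i n i)).+1 n.
have fE m n : \sum_i n i < m%:Z -> f n = s m n.
  move=> nm; rewrite /f; set M := (absz _).+1; have [Mm|mM] := leqP M m.
    apply/eqP; rewrite eq_sym -subr_eq0 -coefB -(subnKC Mm).
    by apply/negPn/negP => /Hd[_]; lia.
  apply/eqP; rewrite -subr_eq0 -coefB -(subnKC (ltnW mM)).
  by apply/negPn/negP => /Hd[_]; lia.
have fpos n : f n - s 0 n != 0 -> forall i, 0 <= n i.
  by rewrite /f -coefB -[(absz _).+1]add0n => /Hd[].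
have fb : exists N, bounded_by f N.
  have [N sN] := coef_bounded (s 0); exists (Order.min 0 N) => n fn i.
  have [/eqP|/fpos n0] := eqVneq (f n - s 0 n) 0; last by rewrite ge_min n0.
  by rewrite subr_eq0 => /eqP E; rewrite E in fn; rewrite ge_min (sN n) ?orbT.
exists (Laurent fb) => m n; rewrite coefB /= => fn.
have nm : m%:Z <= \sum_i n i.
  by rewrite leNgt; apply/negP => /fE E; rewrite E subrr eqxx in fn.
split=> // i.
have [/eqP E|/fpos //] := eqVneq (f n - s 0 n) 0.
rewrite subr_eq0 in E; rewrite (eqP E) -opprB oppr_eq0 -coefB in fn.
by have [] := Hd 0 m n fn.
Qed.

Lemma unit_geom y : vge 1 y -> exists2 z, vge 0 z & z * (1 + y) = 1.
Proof.
move=> y1; pose s m := \sum_(j < m) (- y) ^+ j.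
have yX m : vge m ((- y) ^+ m).
  elim: m => [|m IH]; first exact: vge1.
  by rewrite exprS -add1n; apply: vgeM IH; exact: vgeN.
have [m|z Hz] := @laurent_complete s; first by rewrite /s big_ord_recr /= [X in vge _ X]addrC addKr; exact: yX.
exists z.
  by have := Hz 0; rewrite /s big_ord0 subr0.
apply/eqP; rewrite -subr_eq0; apply/eqP; apply: vge_all => d.
have -> : z * (1 + y) - 1 = (z - s d) * (1 + y) - (- y) ^+ d.
  have E : (1 + y) * s d = 1 - (- y) ^+ d.
    by rewrite /s -[1 in RHS](expr1n _ d) subrXX opprK; congr (_ * _); apply: eq_bigr => i _; rewrite expr1n mul1r.
  by rewrite mulrBl [s d * _]mulrC E opprB [_ ^+ d - 1]addrC addrA addrK.
apply: vgeB (yX d); rewrite -[X in vge X _]addn0; apply: vgeM (Hz d) _.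
by apply: vgeD vge1 _; exact: vge_le y1.
Qed.

Lemma letter_inv (a : 'I_k.+1) t : vge 1 t ->
  letter a + t \is a GRing.unit /\ vge 1 (letter a + t)^-1.
Proof.
move=> t1; pose b : laurent k := lmono [ffun j => (a == j)%:R].
have b1 : vge 1 b.
  apply: vge_le (vge_mono _) => [|i]; last by rewrite ffunE; case: (a == i).
  under eq_bigr do rewrite ffunE.
  by rewrite (bigD1 a) //= eqxx big1 => // i; rewrite eq_sym => /negPf ->.
have ab : b * letter a = 1.
  by rewrite lmonoD; congr lmono; apply/ffunP => i; rewrite !ffunE subrr.
have [z z0 zE] : exists2 z, vge 0 z & z * (1 + b * t) = 1.
  by apply: unit_geom; apply: vge_le (vgeM b1 t1).
have E : z * b * (letter a + t) = 1 by rewrite -mulrA mulrDr ab zE.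
have U : letter a + t \is a GRing.unit by apply/asboolP; exists (z * b).
split=> //; rewrite -[_^-1]mul1r -E mulrK //.
by rewrite -[1%N]add0n; exact: vgeM.
Qed.

Lemma cfrac_cons a s : s != [::] -> cfrac (a :: s) = letter a + (cfrac s)^-1.
Proof. by case: s => // b s _; rewrite /= div1r. Qed.

Lemma cfrac_inv s : s != [::] ->
  cfrac s \is a GRing.unit /\ vge 1 (cfrac s)^-1.
Proof.
elim: s => // a s IH _; have [->|s0] := eqVneq s [::].
  by rewrite /= -[letter a]addr0; apply: letter_inv; exact: vge0.
by rewrite cfrac_cons //; apply: letter_inv; case: (IH s0).
Qed.

Lemma cfrac_unit s : s != [::] -> cfrac s \is a GRing.unit.
Proof. by case/cfrac_inv. Qed.

Lemma cfrac_rcons s b : s != [::] -> vge (size s) (cfrac (rcons s b) - cfrac s).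
Proof.
elim: s => // a s IH _; have [->|s0] := eqVneq s [::].
  by rewrite /= addrC addKr div1r; case: (@cfrac_inv [:: b]).
have r0 : rcons s b != [::] by case: (s).
rewrite rcons_cons !cfrac_cons // opprD addrACA subrr add0r.
have [[Us Ps] [Ur Pr]] := (cfrac_inv s0, cfrac_inv r0).
have -> : (cfrac (rcons s b))^-1 - (cfrac s)^-1 =
    - ((cfrac (rcons s b))^-1 * (cfrac s)^-1 * (cfrac (rcons s b) - cfrac s)).
  rewrite mulrBr mulrAC mulVr // mul1r -mulrA mulVr // mulr1.
  by rewrite opprB.
apply: vgeN; apply: vge_le (vgeM (vgeM Pr Ps) (IH s0)) => /=; lia.
Qed.

Lemma CF_cvg u : converges (convergent u) (CF u).
Proof.
suff H : exists l, converges (convergent u) l by exact: (xgetPex 0 H).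
have [m|l Hl] := @laurent_complete (convergent u).
  rewrite /convergent mkseqS.
  by apply: vge_le (@cfrac_rcons (mkseq u m.+1) (u m.+1) _); rewrite // size_mkseq.
exists l => e e0.
have [d de] : exists d : nat, (2%:R : rat) ^ (- d%:Z) < e.
  exists (Num.bound e^-1); rewrite -exprnN invf_plt ?posrE ?exprn_gt0 //.
  exact: Num.Theory.upper_nthrootP.
exists d.+1 => m dm; apply: lt_trans de; apply/norm_ltP => n.
rewrite -opprB coefN oppr_eq0 => /Hl[_]; lia.
Qed.

End ContinuedFractions.

Section Words.
Variable T : Type.
Implicit Types (W : seq T) (eps : nat -> T).

(* word W0 eps i is W_i, where W_(i+1) = W_i eps_i W_i. *)
Fixpoint word W eps (i : nat) : seq T :=
  if i is j.+1 then word W eps j ++ eps j :: word W eps j else W.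

Lemma size_word W eps i : (i <= size (word W eps i))%N.
Proof. by elim: i => //= i IH; rewrite size_cat /= addnS ltnS (leq_trans IH) ?leq_addr. Qed.

(* The infinite sequence P(W0, eps): W_(j+1) has more than j letters (size_word),
   and every W_i is a prefix of the sequence (word_prefix). *)
Definition Pseq W eps : nat -> T :=
  fun j => nth (eps 0) (word W eps j.+1) j.

Lemma nth_word W eps x0 i j : (j < size (word W eps i))%N ->
  nth x0 (word W eps i) j = Pseq W eps j.
Proof.
have step m d : (j < size (word W eps m))%N ->
    nth x0 (word W eps (m + d)) j = nth x0 (word W eps m) j.
  move=> jm; elim: d => [|d IH]; first by rewrite addn0.
  suff H : (j < size (word W eps (m + d)))%N by rewrite addnS /= nth_cat H.
  by elim: d {IH} => [|d IH]; rewrite ?addn0 // addnS /= size_cat ltn_addr.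
have jj : (j < size (word W eps j.+1))%N by exact: size_word.
move=> ji; rewrite /Pseq (set_nth_default x0) //.
by rewrite -(step i j.+1) // addnC step.
Qed.

Lemma word_prefix W eps i :
  word W eps i = mkseq (Pseq W eps) (size (word W eps i)).
Proof.
apply: (@eq_from_nth _ (eps 0)) => [|j ji]; first by rewrite size_mkseq.
by rewrite nth_mkseq // nth_word.
Qed.

End Words.

(* Main.v *)
(* Let p, q be the first column of the product M(W) of the matrices
   [[a, 1], [1, 0]] over the letters of W, so that p / q is the continued
   fraction of W.  By Cayley-Hamilton, M(W e W) = t M(W) - det M(W) adj [[e, 1], [1, 0]]
   with t = e p + s, s being the sum of the off-diagonal entries of M(W).  In
   characteristic 2 this gives p_(i+1) = t_i p_i, s_(i+1) = t_i s_i and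
   q_(i+1) = t_i q_i + 1.  Hence s_i / p_i is a constant c, and y_i = 1 / p_i
   satisfies y_i^2 = (eps_i + c) y_(i+1), while 1 / CF(u) = q_0 / p_0 + y_1 + y_2 + ...
   Splitting this series according to i mod n yields x_0, ..., x_(n-1), and
   x_j^2 is a multiple of x_(j+1) for j + 1 < n, of x_0 - y_0 for j + 1 = n.
   So the span V of 1, x_0, ..., x_(n-1) over F_2(A) is closed under squaring;
   as dim V <= n + 1, the n + 2 elements 1, z, z^2, z^4, ..., z^(2^n) of V, for
   z = 1 / CF(u), are linearly dependent. *)

Require Import Defs.
From mathcomp Require Import all_boot all_order all_algebra.
From mathcomp Require Import boolp mpoly ring zify.

Set Implicit Arguments.
Unset Strict Implicit.
Unset Printing Implicit Defensive.

Import Order.TTheory GRing.Theory Num.Theory.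
Local Open Scope ring_scope.

(** * Linear dependence and algebraic elements *)

Section LinearDependence.
Variables (K L : fieldType) (phi : {rmorphism K -> L}).

Definition spanned m (x : 'I_m -> L) (z : L) : Prop :=
  exists a : 'I_m -> K, z = \sum_i phi (a i) * x i.

Section Spanned.
Variables (m : nat) (x : 'I_m -> L).

Lemma spanned_id i : spanned x (x i).
Proof.
exists (fun j => (j == i)%:R); rewrite (bigD1 i) //= eqxx rmorph1 mul1r.
by rewrite big1 ?addr0 // => j /negPf ->; rewrite rmorph0 mul0r.
Qed.

Lemma spanned0 : spanned x 0.
Proof. by exists (fun=> 0); rewrite big1 // => i _; rewrite rmorph0 mul0r. Qed.

Lemma spannedD y z : spanned x y -> spanned x z -> spanned x (y + z).
Proof.
move=> [a ->] [b ->]; exists (fun i => a i + b i).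
by rewrite -big_split; apply: eq_bigr => i _; rewrite rmorphD mulrDl.
Qed.

Lemma spannedZ c z : spanned x z -> spanned x (phi c * z).
Proof.
move=> [a ->]; exists (fun i => c * a i).
by rewrite mulr_sumr; apply: eq_bigr => i _; rewrite rmorphM mulrA.
Qed.

Lemma spanned_sum I (r : seq I) (F : I -> L) :
  (forall i, spanned x (F i)) -> spanned x (\sum_(i <- r) F i).
Proof.
by move=> xF; elim/big_rec: _ => [|i z _]; [exact: spanned0|exact: spannedD].
Qed.

(** The coefficients form a matrix with m + 1 rows and m columns, so its left kernel is nonzero. *)
Lemma spanned_dep (z : 'I_m.+1 -> L) : (forall j, spanned x (z j)) ->
  exists2 v : 'I_m.+1 -> K, (exists j, v j != 0) & \sum_j phi (v j) * z j = 0.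
Proof.
move=> /choice[a za]; pose A := \matrix_(j < m.+1, i < m) a j i.
have /rowV0Pn[v /sub_kermxP vA v0] : kermx A != 0.
  by rewrite -mxrank_eq0 mxrank_ker subn_eq0 -ltnNge ltnS rank_leq_col.
exists (v 0); first by have /rV0Pn := v0.
under eq_bigr do rewrite za mulr_sumr.
rewrite exchange_big big1 // => i _.
have := congr1 (fun B : 'rV_m => phi (B 0 i)) vA.
rewrite !mxE rmorph0 rmorph_sum => vAi.
rewrite -[RHS](mul0r (x i)) -[in RHS]vAi mulr_suml; apply: eq_bigr => j _.
by rewrite mxE rmorphM mulrA.
Qed.

(** Dividing a dependence between the powers [z ^+ e j] by [z ^+ D] gives a polynomial relation for
    [z^-1]. Its exponents [D - e j] are distinct, so no coefficients cancel. *)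
Lemma spanned_expr_algebraic (z : L) (e : 'I_m.+1 -> nat) D :
  z != 0 -> injective e -> (forall j, (e j <= D)%N) ->
  (forall j, spanned x (z ^+ e j)) ->
  exists P : {poly K},
    [/\ P != 0, (size P <= D.+1)%N & root (map_poly phi P) z^-1].
Proof.
move=> z0 e_inj eD /spanned_dep[v [j0 vj0] vz].
exists (\sum_j v j *: 'X^(D - e j)); split.
- apply/eqP => /(congr1 (fun P : {poly K} => P`_(D - e j0))) /eqP.
  rewrite coef0 coef_sum (bigD1 j0) //= coefZ coefXn eqxx mulr1.
  rewrite big1 ?addr0 ?(negPf vj0) // => j jj0; rewrite coefZ coefXn.
  have /negPf : e j != e j0 by rewrite (inj_eq e_inj).
  have := eD j; have := eD j0 => eDj0 eDj ejj0.
  by case: eqP => [|_]; [lia|rewrite mulr0].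
- apply: (leq_trans (size_sum _ _ _)); apply/bigmax_leqP => j _.
  by apply: (leq_trans (size_scale_leq _ _)); rewrite size_polyXn ltnS leq_subr.
- apply/rootP; rewrite rmorph_sum horner_sum /=.
  rewrite -[RHS](mulr0 (z ^- D)) -[X in _ = _ * X]vz mulr_sumr; apply: eq_bigr => j _.
  rewrite linearZ /= map_polyXn hornerZ hornerXn.
  rewrite -[X in _ = _ ^- X * _](subnK (eD j)) exprD invfM exprVn.
  by rewrite mulrCA mulfVK ?expf_neq0.
Qed.

End Spanned.

Lemma spanned_square_algebraic m (x : 'I_m.+1 -> L) (z : L) :
  2%N \in [pchar L] -> x ord0 = 1 -> (forall i, spanned x (x i ^+ 2)) ->
  spanned x z -> z != 0 ->
  exists P : {poly K},
    [/\ P != 0, (size P <= (2 ^ m).+1)%N & root (map_poly phi P) z^-1].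
Proof.
move=> L2 x0 xx xz z0.
(* Frobenius is additive, so only the squares of the spanning elements matter. *)
have xsq y : spanned x y -> spanned x (y ^+ 2).
  case=> a ->; rewrite -(pFrobenius_autE L2) rmorph_sum /=; apply: spanned_sum => i.
  by rewrite pFrobenius_autE exprMn -rmorphXn; apply: spannedZ.
have xpow j : spanned x (z ^+ (2 ^ j)).
  by elim: j => [|j IH]; rewrite ?expr1 // expnS mulnC exprM; apply: xsq.
(* The m + 2 exponents 0, 1, 2, 4, ..., 2^m. *)
pose e (j : 'I_m.+2) := if j == ord0 then 0%N else (2 ^ j.-1)%N.
have e_inj : injective e.
  move=> i j; rewrite /e; have [->|i0] := eqVneq i ord0; have [->|j0] := eqVneq j ord0 => //.
  - by have := expn_gt0 2 j.-1 => /= /[swap] <-.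
  - by have := expn_gt0 2 i.-1 => /= /[swap] ->.
  move/(expnI (isT : 1 < 2)%N) => ij; apply: val_inj => /=.
  by rewrite -[LHS]prednK ?lt0n // ij prednK ?lt0n.
apply: (@spanned_expr_algebraic _ x z e) => // j; rewrite /e.
  case: eqVneq => // _; rewrite leq_exp2l //; have := ltn_ord j; lia.
by case: eqVneq => _; rewrite ?xpow // expr0 -x0; exact: spanned_id.
Qed.

End LinearDependence.

(** * Matrix products along words *)

Section WordMatrix.
Variables (R : comNzRingType) (T : Type) (f : T -> R).

Definition letter_mx (a : R) : 'M[R]_2 :=
  \matrix_(i, j) if i == 0 then (if j == 0 then a else 1) else (j == 0)%:R.

Definition word_mx (s : seq T) : 'M[R]_2 :=
  foldr (fun a M => letter_mx (f a) *m M) 1%:M s.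

Lemma mulmx2E (A B : 'M[R]_2) i j :
  (A *m B) i j = A i 0 * B 0 j + A i 1 * B 1 j.
Proof.
rewrite mxE !big_ord_recl big_ord0 addr0; congr (_ + A _ _ * B _ _); exact: val_inj.
Qed.

Lemma word_mx_cat s t : word_mx (s ++ t) = word_mx s *m word_mx t.
Proof. by elim: s => [|a s IH] /=; rewrite ?mul1mx // IH mulmxA. Qed.

Lemma word_mx_cons0 a s j :
  word_mx (a :: s) 0 j = f a * word_mx s 0 j + word_mx s 1 j.
Proof. by rewrite /= mulmx2E !mxE /= mul1r. Qed.

Lemma word_mx_cons1 a s j : word_mx (a :: s) 1 j = word_mx s 0 j.
Proof. by rewrite /= mulmx2E !mxE /= mul1r mul0r addr0. Qed.

Definition word_mxE := (word_mx_cons0, word_mx_cons1).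

(** Each letter matrix has determinant -1. *)
Lemma word_mx_det s : word_mx s 0 0 * word_mx s 1 1 - word_mx s 0 1 * word_mx s 1 0
  = (-1) ^+ size s.
Proof.
elim: s => [|a s IH]; first by rewrite !mxE /= expr0; ring.
by rewrite !word_mxE exprS -IH; ring.
Qed.

Section Fold.
Variables (s : seq T) (a : T).
Let M := word_mx s.
Let M' := word_mx (s ++ a :: s).

(** The trace of [M *m letter_mx (f a)]. *)
Definition fold_factor := M 0 0 * f a + (M 0 1 + M 1 0).

(* Cayley-Hamilton for [M *m X], [X := letter_mx (f a)], in the form
   [M *m X *m M = tr (M *m X) *: M - \det M *: \adj X]. *)
Lemma word_mx_fold :
  [/\ M' 0 0 = fold_factor * M 0 0,
      M' 1 0 = fold_factor * M 1 0 + (-1) ^+ size s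
    & M' 0 1 = fold_factor * M 0 1 + (-1) ^+ size s].
Proof.
rewrite -word_mx_det /M' word_mx_cat !(mulmx2E (word_mx s)) !word_mxE /fold_factor -/M.
by split; ring.
Qed.

End Fold.

Variables (W0 : seq T) (eps : nat -> T).
Hypothesis R2 : 2%N \in [pchar R].
Local Notation M i := (word_mx (word W0 eps i)).

(** Folding multiplies both p and s by [fold_factor]: the two signs added to s cancel in
    characteristic 2. Denominators are cleared because p need not be a unit of [R]. *)
Lemma word_mx_trace_ratio i :
  M i 0 0 * (M 0 0 1 + M 0 1 0) = M 0 0 0 * (M i 0 1 + M i 1 0).
Proof.
elim: i => //= i IH; have [-> -> ->] := word_mx_fold (word W0 eps i) (eps i).
rewrite addrACA -mulrDr addrr_pchar2 // addr0 -mulrA IH; ring.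
Qed.

End WordMatrix.

Lemma word_mx_rmorph (R S : comNzRingType) (T : Type) (g : {rmorphism R -> S})
    (f : T -> R) s i j :
  word_mx (g \o f) s i j = g (word_mx f s i j).
Proof.
elim: s i j => [|a s IH] i j; first by rewrite !mxE rmorph_nat.
rewrite /= !mulmx2E !IH rmorphD !rmorphM.
by rewrite !mxE /=; case: (i == 0); rewrite ?rmorph1 ?rmorph0.
Qed.

Lemma eq_word_mx (R : comNzRingType) (T : Type) (f g : T -> R) s i j :
  f =1 g -> word_mx f s i j = word_mx g s i j.
Proof.
by move=> fg; elim: s i j => //= a s IH i j; rewrite !mulmx2E !IH fg.
Qed.

(** * Continued fractions of words and their limits *)

Section LaurentWords.
Variable k : nat.
Implicit Types (a : 'I_k.+1) (s : seq 'I_k.+1) (u : nat -> 'I_k.+1) (z l : laurent k).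
Local Notation M := (word_mx (@letter k)).

Lemma laurent_pchar2 : 2%N \in [pchar (laurent k)].
Proof. exact: (rmorph_pchar (@lconst k) (pchar_Fp (isT : prime 2))). Qed.

Lemma laurent_oppr z : - z = z.
Proof. exact: oppr_pchar2 laurent_pchar2 _. Qed.

Lemma laurent_sqrB z l : (z - l) ^+ 2 = z ^+ 2 - l ^+ 2.
Proof.
by rewrite sqrrB mulrn_pchar ?laurent_pchar2 // subr0 laurent_oppr.
Qed.

Lemma word_mx_poly_embed s i j :
  M s i j = poly_embed (word_mx (fun a => 'X_a) s i j).
Proof.
rewrite -word_mx_rmorph.
apply: eq_word_mx => a /=.
rewrite /poly_embed.
rewrite mmapX.
by rewrite mmap1U.
Qed.

Lemma word_mx_cfrac a s : M (a :: s) 0 0 = cfrac (a :: s) * M s 0 0.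
Proof.
elim: s a => [|b s IH] a; first by rewrite word_mxE !mxE /= mulr1 addr0.
rewrite word_mx_cons0 word_mx_cons1 cfrac_cons // mulrDl; congr (_ + _).
by rewrite IH mulKr // cfrac_unit.
Qed.

(** By [word_mx_cfrac], p is the product of the continued fractions of the nonempty suffixes of [s],
    and each of these has an inverse of valuation at least 1. *)
Lemma word_mx_unit s : M s 0 0 \is a GRing.unit /\ vge (size s) (M s 0 0)^-1.
Proof.
elim: s => [|a s [Us vs]]; first by rewrite !mxE invr1; split; [exact: unitr1|exact: vge1].
have [Ua va] : cfrac (a :: s) \is a GRing.unit /\ vge 1%N (cfrac (a :: s))^-1.
  exact: cfrac_inv.
rewrite word_mx_cfrac unitrM Us Ua invrM //; split => //.
by rewrite /= -addn1; exact: vgeM.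
Qed.

Lemma cfrac_invE s : s != [::] -> (cfrac s)^-1 = M s 1 0 / M s 0 0.
Proof.
case: s => // a s _; rewrite word_mx_cons1 word_mx_cfrac.
have [Us _] := word_mx_unit s; have Ua : cfrac (a :: s) \is a GRing.unit by exact: cfrac_unit.
by rewrite invrM // mulVKr.
Qed.

Lemma vge_converges (c : nat -> laurent k) l :
  (forall m, vge m (l - c m)) -> converges c l.
Proof.
move=> cl e e0.
have [d de] : exists d : nat, (2%:R : rat) ^ (- d%:Z) < e.
  exists (Num.bound e^-1); rewrite -exprnN invf_plt ?posrE ?exprn_gt0 //.
  exact: Num.Theory.upper_nthrootP.
exists d.+1 => m dm; apply: lt_trans de; apply/norm_ltP => p.
by rewrite -opprB Defs.coefN oppr_eq0 => /cl[_]; lia.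
Qed.

Lemma CF_vge u m : vge m (CF u - convergent u m).
Proof.
have [i|l Hl] := @laurent_complete _ (convergent u).
  rewrite /convergent mkseqS.
  by apply: vge_le (@cfrac_rcons _ (mkseq u i.+1) (u i.+1) _); rewrite // size_mkseq.
by rewrite (converges_unique (@CF_cvg _ u) (vge_converges Hl)).
Qed.

Lemma CF_inv u : CF u \is a GRing.unit /\
  forall m, vge m ((CF u)^-1 - (convergent u m)^-1).
Proof.
have [U v1] : CF u \is a GRing.unit /\ vge 1%N (CF u)^-1.
  (* [CF u] is [letter (u 0)] plus the term [1 / letter (u 1) + (CF u - convergent u 1)], which
     satisfies [vge 1]. *)
  rewrite -(subrK (convergent u 1%N) (CF u)) [X in _ + X]/convergent /= addrCA div1r.
  apply: letter_inv; apply: vgeD (@CF_vge u 1%N) _.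
  by case: (@cfrac_inv _ [:: u 1%N]).
split=> // m.
have [Uc vc] : convergent u m \is a GRing.unit /\ vge 1%N (convergent u m)^-1.
  exact: cfrac_inv.
have -> : (CF u)^-1 - (convergent u m)^-1 =
    - ((CF u)^-1 * (convergent u m)^-1 * (CF u - convergent u m)).
  by rewrite mulrBr mulrAC mulVr // mul1r mulrVK // opprB.
by apply: vgeN; apply: vge_le (vgeM (vgeM v1 vc) (@CF_vge u m)); lia.
Qed.

Lemma vge_sum (I : Type) (r : seq I) d (F : I -> laurent k) :
  (forall i, vge d (F i)) -> vge d (\sum_(i <- r) F i).
Proof.
by move=> Fd; elim/big_rec: _ => [|i x _]; [exact: vge0|exact: vgeD].
Qed.

(** * Series split along arithmetic progressions *)

Section ProgressionSums.
Variables (y : nat -> laurent k) (n : nat).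
Hypothesis y_vge : forall i, vge i (y i).

(** Convergence of the series for x_j, stated through its truncation errors. The index j is not
    restricted to j < n, so that x_n is available for the wrap-around. *)
Definition prog_sum (x : nat -> laurent k) : Prop :=
  forall j N, vge N (x j - \sum_(m < N) y (j + m * n)%N).

Lemma prog_sum_exists : (0 < n)%N -> exists x, prog_sum x.
Proof.
move=> n_gt0.
suff /choice[x xP] : forall j, exists l, forall N,
    vge N (l - \sum_(m < N) y (j + m * n)%N) by exists x.
move=> j; apply: laurent_complete => N /=; rewrite big_ord_recr [X in vge _ X]addrC addKr.
by apply: vge_le (@y_vge _); rewrite (leq_trans (leq_pmulr N n_gt0)) ?leq_addl.
Qed.

Variable x : nat -> laurent k.
Hypothesis xP : prog_sum x.

Lemma prog_sum_shift j : x j = y j + x (j + n)%N.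
Proof.
apply/eqP; rewrite -subr_eq0; apply/eqP; apply: vge_all => N.
have := vgeB (vge_le (leqnSn N) (@xP j N.+1)) (@xP (j + n)%N N).
rewrite big_ord_recl addn0.
have -> : \sum_(m < N) y (j + lift ord0 m * n)%N = \sum_(m < N) y (j + n + m * n)%N.
  by apply: eq_bigr => m _; rewrite lift0 mulSn addnA.
by congr vge; ring.
Qed.

(** If y_i^2 / y_(i+1) is constant along the progression of j, termwise squaring by Frobenius proves
    the identity for partial sums; the errors tend to 0. *)
Lemma prog_sum_square j :
  (forall m, y j.+1 * y (j + m * n)%N ^+ 2 = y j ^+ 2 * y (j + m * n).+1) ->
  y j.+1 * x j ^+ 2 = y j ^+ 2 * x j.+1.
Proof.
move=> yy; apply/eqP; rewrite -subr_eq0; apply/eqP; apply: vge_all => N.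
pose s i := \sum_(m < N) y (i + m * n)%N.
have ss : y j.+1 * s j ^+ 2 = y j ^+ 2 * s j.+1.
  rewrite -(pFrobenius_autE laurent_pchar2) rmorph_sum !mulr_sumr /=.
  by apply: eq_bigr => m _; rewrite pFrobenius_autE yy addSn.
have -> : y j.+1 * x j ^+ 2 - y j ^+ 2 * x j.+1 =
    y j.+1 * (x j - s j) ^+ 2 - y j ^+ 2 * (x j.+1 - s j.+1).
  by rewrite laurent_sqrB !mulrBr ss; ring.
have v := vgeM (@xP j N) (@xP j N).
rewrite !expr2; apply: vgeB.
  by apply: vge_le (vgeM (@y_vge j.+1) v); lia.
by apply: vge_le (vgeM (vgeM (@y_vge j) (@y_vge j)) (@xP j.+1 N)); lia.
Qed.

Lemma prog_sum_total N : vge N (\sum_(j < n) x j - \sum_(i < N * n) y i).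
Proof.
have -> : \sum_(i < N * n) y i = \sum_(j < n) \sum_(m < N) y (j + m * n)%N.
  rewrite exchange_big; elim: N => [|N IH]; first by rewrite !big_ord0.
  rewrite mulSn addnC big_split_ord big_ord_recr /= IH; congr (_ + _).
  by apply: eq_bigr => j _; rewrite addnC.
by rewrite -sumrB; apply: vge_sum => j; exact: (@xP).
Qed.

End ProgressionSums.

(** * The series for 1 / CF(u) *)

Section WordSequence.
Variables (W0 : seq 'I_k.+1) (eps : nat -> 'I_k.+1).
Local Notation W i := (word W0 eps i).

Definition winv (i : nat) : laurent k := (M (W i) 0 0)^-1.

Lemma winv_vge i : vge i (winv i).
Proof. by apply: vge_le (word_mx_unit (W i)).2; exact: size_word. Qed.

Lemma winv_unit i : winv i \is a GRing.unit.
Proof. by rewrite unitrV (word_mx_unit _).1. Qed.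

(** The ratio y_i^2 / y_(i+1) = eps_i + c depends on i only through eps_i. *)
Lemma winv_square i j : eps i = eps j ->
  winv j.+1 * winv i ^+ 2 = winv j ^+ 2 * winv i.+1.
Proof.
move=> eij; have U m : M (W m) 0 0 \is a GRing.unit by exact: (word_mx_unit _).1.
pose s m := M (W m) 0 1 + M (W m) 1 0.
have ratio m : M (W m) 0 0 * s 0%N = M (W 0) 0 0 * s m.
  exact: (word_mx_trace_ratio _ _ _ laurent_pchar2).
have st m : M (W m.+1) 0 0 = (M (W m) 0 0 * letter (eps m) + s m) * M (W m) 0 0.
  by have [] := word_mx_fold (@letter k) (W m) (eps m).
(* Both ratios s / p equal the one at index 0; the unit p_0 cancels. *)
have sij : M (W i) 0 0 * s j = M (W j) 0 0 * s i.
  apply: (mulrI (U 0%N)); by rewrite mulrCA -ratio mulrCA [RHS]mulrCA -ratio mulrCA.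
rewrite /winv !exprVn -!invrM ?unitrX //; congr _^-1.
rewrite !st eij.
transitivity (M (W i) 0 0 * M (W j) 0 0 *
  (M (W i) 0 0 * M (W j) 0 0 * letter (eps j) + M (W i) 0 0 * s j)); first by ring.
by rewrite sij; ring.
Qed.

Lemma cfrac_word_inv i : W i != [::] -> (cfrac (W i))^-1 =
  M W0 1 0 * winv 0 - winv 0 + \sum_(j < i.+1) winv j.
Proof.
move=> Wi; rewrite cfrac_invE // -/(winv i); elim: i {Wi} => [|i IH].
  by rewrite big_ord1 subrK.
rewrite big_ord_recr addrA -IH /=.
have [E _ _] := word_mx_fold (@letter k) (W i) (eps i).
have [_ -> _] := word_mx_fold (@letter k) (W i) (eps i).
have U m : M (W m) 0 0 \is a GRing.unit by exact: (word_mx_unit _).1.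
rewrite laurent_oppr expr1n mulrDl mul1r; congr (_ + _).
rewrite /winv /= E invrM //; last first.
  by have := U i.+1; rewrite /= E unitrM => /andP[].
have Ut : fold_factor (@letter k) (W i) (eps i) \is a GRing.unit.
  by have := U i.+1; rewrite /= E unitrM => /andP[].
by rewrite mulrC -mulrA mulKr // mulrC.
Qed.

Lemma CF_Pseq_inv n x : (0 < n)%N -> prog_sum winv n x ->
  (CF (Pseq W0 eps))^-1 = M W0 1 0 * winv 0 - winv 0 + \sum_(j < n) x j.
Proof.
move=> n0 xP; apply/eqP; rewrite -subr_eq0; apply/eqP; apply: vge_all => N.
(* With r + 1 = (N + 2) n the sum for [W r] covers whole periods, as in [prog_sum_total], and N < r
   gives [W r] more than N letters. *)
have [r rE] : exists r, (N.+2 * n = r.+1)%N by exists (N.+2 * n).-1; nia.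
have rN : (N < r)%N by nia.
have Wr : (N < size (W r))%N by apply: leq_trans (size_word _ _ _).
have cW : convergent (Pseq W0 eps) (size (W r)).-1 = cfrac (W r).
  by rewrite /convergent prednK ?(leq_trans _ Wr) // -word_prefix.
have [_ /(_ (size (W r)).-1)] := CF_inv (Pseq W0 eps).
rewrite cW cfrac_word_inv; last by case: (W r) Wr.
have := @prog_sum_total _ _ _ xP N.+2; rewrite rE => v2 v1.
have := vgeB (vge_le _ v1) (vge_le _ v2) => /(_ N).
have -> // : forall a b c d : laurent k, a - (d + b) - (c - b) = a - (d + c).
  by move=> a b c d; ring.
by apply; lia.
Qed.

End WordSequence.
End LaurentWords.

(** * Passage to the fraction field and conclusion *)

Local Notation "x %:F" := (FracField.tofrac x).

Lemma tofracV (R : idomainType) (a : R) : a \is a GRing.unit -> a^-1%:F = (a%:F)^-1.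
Proof. by move=> Ua; rewrite rmorphV. Qed.

Lemma winv_rational k (W0 : seq 'I_k.+1) eps i :
  exists c, (winv W0 eps i)%:F = rat_embed c.
Proof.
have [U _] := word_mx_unit (word W0 eps i).
exists (((word_mx (fun a => 'X_a) (word W0 eps i) 0 0)%:F)^-1).
by rewrite fmorphV /= rat_embed_poly -word_mx_poly_embed tofracV.
Qed.

Theorem theorem1p1 (k n : nat) (W0 : seq 'I_k.+1) (eps : nat -> 'I_k.+1)
    (n_ge1 : (1 <= n)%N) (eps_periodic : forall i : nat, eps (i + n)%N = eps i) :
  algebraic_of_degree_le (2 ^ n)%N (CF (Pseq W0 eps)).
Proof.
have [x xP] := prog_sum_exists (@winv_vge _ W0 eps) n_ge1.
have epsM j m : eps (j + m * n)%N = eps j.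
  by elim: m => [|m IH]; rewrite ?addn0 // mulSnr addnA eps_periodic.
have xsq j : (x j)%:F ^+ 2 =
    (winv W0 eps j)%:F ^+ 2 / (winv W0 eps j.+1)%:F * (x j.+1)%:F.
  have U : (winv W0 eps j.+1)%:F != 0.
    rewrite tofrac_eq0; apply: contraTneq (winv_unit W0 eps j.+1) => ->.
    by rewrite unitr0.
  apply: (mulfI U); rewrite [RHS]mulrA [X in _ = X * _]mulrC divfK // -!tofracXn -!tofracM.
  congr _%:F; apply: (prog_sum_square (@winv_vge _ W0 eps) xP) => m.
  by rewrite winv_square // epsM.
(* The spanning family 1, x_0, ..., x_(n-1), with the x's shifted by one index. *)
pose b (i : 'I_n.+1) := if i == 0 then 1 else (x i.-1)%:F.
have b1 : spanned (@rat_embed k) b 1 by exact: (spanned_id (@rat_embed k) b 0).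
have brat c : spanned (@rat_embed k) b (rat_embed c).
  by rewrite -[rat_embed c]mulr1; exact: spannedZ.
have bx j : (j < n)%N -> spanned (@rat_embed k) b (x j)%:F.
  by move=> jn; have := spanned_id (@rat_embed k) b (lift 0 (Ordinal jn)).
have bsq i : spanned (@rat_embed k) b (b i ^+ 2).
  rewrite {2}/b; have [_|i0] := eqVneq i 0; first by rewrite expr1n.
  rewrite xsq; have [[c ->] [d ->]] :=
    (winv_rational W0 eps i.-1, winv_rational W0 eps i.-1.+1).
  rewrite -rmorphXn -fmorph_div; apply: spannedZ.
  have [/bx //|ni] := ltnP i.-1.+1 n.
  (* Wrap-around: x_n is x_0 without its first term y_0, which is rational. *)
  have -> : i.-1.+1 = (0 + n)%N by have := ltn_ord i; lia.
  have -> : x (0 + n)%N = x 0%N - winv W0 eps 0.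
    by rewrite [X in X - _](prog_sum_shift xP) addrC addKr.
  have [e E] := winv_rational W0 eps 0.
  by rewrite tofracB E -rmorphN; apply: spannedD; [exact: bx|exact: brat].
have [U _] := CF_inv (Pseq W0 eps).
have L2 : 2%N \in [pchar {fraction laurent k}].
  exact: (rmorph_pchar (@FracField.tofrac _) (laurent_pchar2 k)).
have [||P [P0 sP rP]] := spanned_square_algebraic L2 (erefl : b ord0 = 1) bsq
  (z := (CF (Pseq W0 eps))^-1%:F).
- rewrite (CF_Pseq_inv n_ge1 xP) rmorphD rmorph_sum; apply: spannedD.
    have [e E] := winv_rational W0 eps 0.
    rewrite rmorphB rmorphM /= E word_mx_poly_embed -rat_embed_poly -rmorphM -rmorphB.
    exact: brat.
  by apply: spanned_sum => j; exact: bx.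
- by rewrite tofrac_eq0 invr_eq0; apply: contraTneq U => ->; rewrite unitr0.
by rewrite -tofracV ?invrK ?unitrV // in rP; exists P.
Qed.
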